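(* Let $m\ge 2$. For each $n\in\mathbb{N}$ let $\Omega_n\subset\mathbb{R}^m$ be a non-empty open set with $|\Omega_n|<\infty$, and let $f_n\in L^2(\Omega_n)$ satisfy $\|f_n\|_2=1$ and $f_n\ge 0$. Then the sequence $(f_n)$ localises if and only if $$\lim_{n\rightarrow\infty}\frac{1}{|\Omega_n|}\|f_n\|_1^2=0.$$
   Context: $|A|$ denotes the Lebesgue measure of a measurable set $A\subset\mathbb{R}^m$, and $\|\cdot\|_p$ is the standard $L^p(\Omega_n)$ norm. Definition (localisation): a sequence $(f_n)$ with $f_n\in L^2(\Omega_n)$ and $\|f_n\|_2=1$ for $n\in\mathbb{N}$ localises if there exists a sequence of measurable sets $A_n\subset\Omega_n$ such that $$\lim_{n\rightarrow\infty}\frac{|A_n|}{|\Omega_n|}=0\quad\text{and}\quad \lim_{n\rightarrow\infty}\int_{A_n}f_n^2=1.$$ *)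

(* Defs.v *)
From HB Require Import structures.
From mathcomp Require Import all_boot all_order all_algebra.
From mathcomp Require Import all_classical all_reals all_analysis.

Set Implicit Arguments.
Unset Strict Implicit.
Unset Printing Implicit Defensive.

Import Order.TTheory GRing.Theory Num.Theory.
Import numFieldTopology.Exports numFieldNormedType.Exports.

Local Open Scope classical_set_scope.
Local Open Scope ring_scope.

(* Lebesgue measure on R^m, realised as 'rV[R]_m: the outer measure of A is the
   infimum of the total volume of a countable cover of A by half-open boxes, and
   the measurable sets are the Caratheodory measurable ones, so the resulting
   sigma-algebra is the (complete) Lebesgue sigma-algebra. *)
Section lebesgue_rV.
Context {R : realType} {m : nat}.
Implicit Types (B : 'rV[R]_m * 'rV[R]_m) (A : set 'rV[R]_m).

Definition box B : set 'rV[R]_m :=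
  [set x | forall i, B.1 0 i < x 0 i <= B.2 0 i].

Definition box_volume B : R := \prod_(i < m) Num.max 0 (B.2 0 i - B.1 0 i).

(* The covers are indexed by subsets of nat, not by nat itself: in dimension 0
   no box is empty, and set0 has to be covered by the empty family. *)
Definition lebesgue_outer A : \bar R :=
  ereal_inf [set s : \bar R |
    exists (D : set nat) (F : nat -> 'rV[R]_m * 'rV[R]_m),
      A `<=` \bigcup_(k in D) box (F k) /\
      s = \esum_(k in D) (box_volume (F k))%:E]%E.

Lemma box_volume_ge0 B : 0 <= box_volume B.
Proof. by apply: prodr_ge0 => i _; rewrite le_max lexx. Qed.

Let lebesgue_outer_ge0 A : (0 <= lebesgue_outer A)%E.
Proof.
apply: le_ereal_inf_tmp => _ [D [F [_ ->]]].
by apply: esum_ge0 => k _; rewrite lee_fin box_volume_ge0.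
Qed.

Let lebesgue_outer0 : lebesgue_outer set0 = 0%E.
Proof.
apply/eqP; rewrite eq_le lebesgue_outer_ge0 andbT.
apply: ereal_inf_lbound; exists set0, (fun=> (0, 0)).
by rewrite esum_set0; split.
Qed.

Let le_lebesgue_outer :
  {homo lebesgue_outer : A1 A2 / A1 `<=` A2 >-> (A1 <= A2)%E}.
Proof.
move=> A1 A2 A12; apply: ereal_inf_le_tmp => s [D [F [cov ->]]].
by exists D, F; split => //; exact: subset_trans cov.
Qed.

Let lebesgue_outer_sigma_subadditive : sigma_subadditive lebesgue_outer.
Proof.
move=> A; have [[i ioo]|] := pselect (exists i, lebesgue_outer (A i) = +oo%E).
  by rewrite (eseries_pinfty _ _ ioo) ?leey// => n _;
    rewrite -ltNye (lt_le_trans _ (lebesgue_outer_ge0 _)).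
rewrite -forallNE => Aoo; apply/lee_addgt0Pr => e e0.
rewrite (le_trans _ (epsilon_trick _ _ (ltW e0)))//.
have H n : exists G : set nat * (nat -> 'rV[R]_m * 'rV[R]_m),
    A n `<=` \bigcup_(k in G.1) box (G.2 k) /\
    (\esum_(k in G.1) (box_volume (G.2 k))%:E
      <= lebesgue_outer (A n) + (e / (2 ^ n.+1)%:R)%:E)%E.
  have fA : lebesgue_outer (A n) \is a fin_num.
    by rewrite ge0_fin_numE// ltey; apply/eqP/Aoo.
  have en0 : 0 < e / (2 ^ n.+1)%:R :> R by rewrite divr_gt0// ltr0n expn_gt0.
  have [_ [D [F [cov ->]]] /ltW le_s] := lb_ereal_inf_adherent en0 fA.
  by exists (D, F).
have {H} [G DF] := choice H.
pose D n := (G n).1; pose F n := (G n).2.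
have /card_esym/ppcard_eqP[f] := card_nat2.
have fbij : set_bij [set: nat] [set: nat * nat] f by exact: bij.
pose vol (k : nat * nat) := (box_volume (F k.1 k.2))%:E : \bar R.
pose DD := [set: nat] `*`` D.
apply: (@le_trans _ _ (\esum_(k in DD) vol k)%E).
  apply: ereal_inf_lbound.
  exists (f @^-1` DD), (fun k => F (f k).1 (f k).2); split.
    move=> x [n _ Anx]; have [k Dk Bx] := (DF n).1 x Anx.
    by have [_ _ /(_ (n, k) I)[j _ fj]] := fbij; exists j; rewrite /= fj.
  rewrite (reindex_esum (f @^-1` DD) DD f)//.
  have [_ finj fsurj] := fbij; split=> [//|x y _ _|y DDy].
    by apply: finj; rewrite inE.
  by have [x _ xy] := fsurj y I; exists x; rewrite //= xy.
rewrite /DD -(@esum_esum _ _ _ _ _ (fun n k => vol (n, k))); last first.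
  by move=> n k _ _; rewrite lee_fin box_volume_ge0.
rewrite -nneseries_esumT; last first.
  by move=> n; apply: esum_ge0 => k _; rewrite lee_fin box_volume_ge0.
apply: lee_nneseries => [n _ _|n _]; last exact: (DF n).2.
by apply: esum_ge0 => k _; rewrite lee_fin box_volume_ge0.
Qed.

HB.instance Definition _ := isOuterMeasure.Build R 'rV[R]_m lebesgue_outer
  lebesgue_outer0 lebesgue_outer_ge0 le_lebesgue_outer
  lebesgue_outer_sigma_subadditive.

Let outer : {outer_measure set 'rV[R]_m -> \bar R} := lebesgue_outer.

Definition lebesgue_rV :
    {measure set (caratheodory_type lebesgue_outer) -> \bar R} :=
  [the measure _ _ of outer : set (caratheodory_type outer) -> \bar R].

End lebesgue_rV.

Section localisation.
Context {R : realType} {m : nat}.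
Implicit Types (Omega : set 'rV[R]_m) (f : 'rV[R]_m -> R).
Local Open Scope ereal_scope.

(* The norm of L^p(Omega): f is only looked at on Omega, and extended by 0. *)
Definition Lp_norm Omega (p : \bar R) f : \bar R :=
  'N[lebesgue_rV]_p[EFin \o (f \_ Omega)].

Definition in_L2 Omega f : Prop :=
  measurable_fun (Omega : set (caratheodory_type lebesgue_outer)) f /\
  Lp_norm Omega 2%:E f < +oo.

Definition localises (Omega : nat -> set 'rV[R]_m) (f : nat -> 'rV[R]_m -> R)
    : Prop :=
  exists A : nat -> set (caratheodory_type (@lebesgue_outer R m)),
    [/\ forall n, measurable (A n),
        forall n, A n `<=` Omega n,
        lebesgue_rV (A n) / lebesgue_rV (Omega n) @[n --> \oo] --> 0 &
        \int[lebesgue_rV]_(x in A n) (f n x ^+ 2)%:E @[n --> \oo] --> 1].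

End localisation.

(* Main.v *)
Require Import Defs.
From mathcomp Require Import all_boot all_order all_algebra.
From mathcomp Require Import all_classical all_reals all_analysis.
From mathcomp Require Import measurable_realfun ring lra.
Import Order.TTheory GRing.Theory Num.Theory.
Import numFieldTopology.Exports numFieldNormedType.Exports.
Local Open Scope classical_set_scope.
Local Open Scope ring_scope.
Local Open Scope ereal_scope.

(* Let [c_n = ||f_n||_1 / |Omega_n|^(1/2)].  If [(f_n)] localises on [(A_n)],
   the Cauchy-Schwarz inequality on [A_n] and on its complement gives
   [c_n^2 <= 2 (|A_n| / |Omega_n| + 1 - \int_(A_n) f_n^2)].  Conversely, let
   [A_n] be the set where [|f_n| >= |Omega_n|^(-1/2)]: both
   [|A_n| / |Omega_n|] (by Markov's inequality) and the integral of [f_n^2]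
   outside [A_n] are then at most [c_n]. *)

(** * Lebesgue measurability of half-spaces, boxes and open sets *)

(** The two pieces into which the hyperplane [x 0 i = c] cuts a box. If [c] misses the [i]-th side,
    one piece has crossed corners: it is empty, and the truncation at 0 in [box_volume] gives it
    volume 0. *)
Definition box_below {R : realType} {m : nat} (i : 'I_m) (c : R)
    (B : 'rV[R]_m * 'rV[R]_m) : 'rV[R]_m * 'rV[R]_m :=
  (B.1, \row_j if j == i then Num.min (B.2 0 j) c else B.2 0 j)%R.

Definition box_above {R : realType} {m : nat} (i : 'I_m) (c : R)
    (B : 'rV[R]_m * 'rV[R]_m) : 'rV[R]_m * 'rV[R]_m :=
  (\row_j if j == i then Num.max (B.1 0 j) c else B.1 0 j, B.2)%R.

Lemma box_belowE {R : realType} {m : nat} (i : 'I_m) (c : R) B :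
  box (box_below i c B) = box B `&` [set x | (x 0 i <= c)%R].
Proof.
apply/seteqP; split=> [x Bx|x [Bx xc] j] /=; last first.
  rewrite mxE; case: eqVneq => [->|_]; last exact: Bx.
  by have /andP[-> /=] := Bx i; rewrite le_min xc => ->.
have := Bx i; rewrite /= mxE eqxx le_min => /and3P[_ _ xc]; split=> // j.
have := Bx j; rewrite /= mxE; case: ifP => // _.
by rewrite le_min => /and3P[-> ->].
Qed.

Lemma box_aboveE {R : realType} {m : nat} (i : 'I_m) (c : R) B :
  box (box_above i c B) = box B `&` ~` [set x | (x 0 i <= c)%R].
Proof.
apply/seteqP; split=> [x Bx|x [Bx /negP xc] j] /=; last first.
  rewrite mxE; case: eqVneq => [->|_]; last exact: Bx.
  by have /andP[+ ->] := Bx i; rewrite gt_max (ltNge c) xc => ->.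
have := Bx i; rewrite /= mxE eqxx gt_max => /andP[/andP[_ xc] _]; split.
  move=> j; have := Bx j; rewrite /= mxE; case: ifP => // _.
  by rewrite gt_max => /andP[/andP[-> _] ->].
by apply/negP; rewrite -ltNge.
Qed.

(** The cut changes the [i]-th factor only, so [rest] factors out and what remains is additivity of
    length for an interval cut at [c]. *)
Lemma box_volume_split {R : realType} {m : nat} (i : 'I_m) (c : R) B :
  (box_volume (box_below i c B) + box_volume (box_above i c B)
   = box_volume B)%R.
Proof.
pose rest := (\prod_(j < m | j != i) Num.max 0 (B.2 0 j - B.1 0 j))%R.
have vE (C : 'rV[R]_m * 'rV[R]_m) :
    (forall j, j != i -> C.1 0 j = B.1 0 j /\ C.2 0 j = B.2 0 j)%R ->
    box_volume C = (Num.max 0 (C.2 0 i - C.1 0 i) * rest)%R.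
  move=> CB; rewrite /box_volume (bigD1 i)//=; congr (_ * _)%R.
  by apply: eq_bigr => j /CB[-> ->].
rewrite (vE (box_below i c B)); last by move=> j /negbTE ji; rewrite /= mxE ji.
rewrite (vE (box_above i c B)); last by move=> j /negbTE ji; rewrite /= mxE ji.
rewrite (vE B)//.
rewrite -mulrDl /= !mxE eqxx; congr (_ * _)%R.
move: (B.1 0 i)%R (B.2 0 i)%R => a b.
case: (leP b c) => ?; case: (leP a c) => ?; rewrite !maxEle !subr_ge0;
  by repeat (case: leP => ?); lra.
Qed.

(** Caratheodory's criterion: cutting each box of a cover of [X] gives covers of the two parts of
    [X], and their total volumes add up to that of the original cover. *)
Lemma measurable_halfspace {R : realType} {m : nat} (i : 'I_m) (c : R) :
  measurable ([set x | (x 0 i <= c)%R] :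
    set (caratheodory_type (@lebesgue_outer R m))).
Proof.
apply: le_caratheodory_measurable => X.
apply: le_ereal_inf_tmp => _ [D [F [cov ->]]].
under eq_esum do rewrite -(box_volume_split i c) EFinD.
rewrite esumD => [|k _|k _]; rewrite ?lee_fin ?box_volume_ge0//.
apply: leeD; apply: ereal_inf_lbound.
- exists D, (box_below i c \o F); split=> // x [/cov[k Dk Bx] xc].
  by exists k => //=; rewrite box_belowE.
- exists D, (box_above i c \o F); split=> // x [/cov[k Dk Bx] xc].
  by exists k => //=; rewrite box_aboveE.
Qed.

Lemma measurable_box {R : realType} {m : nat} (B : 'rV[R]_m * 'rV[R]_m) :
  measurable (box B : set (caratheodory_type (@lebesgue_outer R m))).
Proof.
have -> : box B = \bigcap_(i in [set: 'I_m])
    (~` [set x | (x 0 i <= B.1 0 i)%R] `&` [set x | (x 0 i <= B.2 0 i)%R]).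
  apply/seteqP; split=> [x Bx i _|x Bx i] /=.
    by have /andP[? ?] := Bx i; split=> //; apply/negP; rewrite -ltNge.
  by have [/negP ? ->] := Bx i I; rewrite andbT ltNge.
apply: (@fin_bigcap_measurable _
  (caratheodory_type (@lebesgue_outer R m))) => // i _.
by apply: measurableI; [apply: measurableC|]; exact: measurable_halfspace.
Qed.

(** An open set is the union of the boxes with rational corners that it contains. All rational pairs
    index the union, which keeps it countable; a box that leaves [U] is replaced by [set0]. *)
Lemma open_measurable_rV {R : realType} {m : nat} (U : set 'rV[R]_m) :
  open U ->
  measurable (U : set (caratheodory_type (@lebesgue_outer R m))).
Proof.
move=> oU; pose Q (q : 'rV[rat]_m * 'rV[rat]_m) : 'rV[R]_m * 'rV[R]_m :=
  (map_mx ratr q.1, map_mx ratr q.2).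
have -> : U = \bigcup_q
    if `[< box (Q q) `<=` U >] then box (Q q) else set0.
  apply/seteqP; split=> [x Ux|x [q _]]; last first.
    by case: asboolP => // + Bx; exact.
  (* The topology on matrices is entrywise: [P] gives one neighbourhood per coordinate, so the
     rational corners can be chosen coordinate by coordinate. *)
  have [P nP PU] : nbhs x U by apply: open_nbhs_nbhs; split.
  have H i : exists q : rat * rat, (ratr q.1 < x 0 i <= ratr q.2)%R /\
      forall y : R, (ratr q.1 < y <= ratr q.2)%R -> P ord0 i y.
    have /nbhs_ballP[e /= e0 eP] := nP ord0 i.
    have [q1] : exists q, ratr q \in `]x 0 i - e, x 0 i[%R.
      by apply: rat_in_itvoo; rewrite ltrBlDr ltrDl.
    have [q2] : exists q, ratr q \in `]x 0 i, x 0 i + e[%R.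
      by apply: rat_in_itvoo; rewrite ltrDl.
    rewrite !in_itv/= => /andP[xq2 q2e] /andP[eq1 q1x].
    exists (q1, q2); split=> /= [|y /andP[q1y yq2]].
      by rewrite q1x ltW.
    by apply: eP; rewrite /ball /= ltr_distlC; apply/andP; split; lra.
  have [q qP] := choice H.
  exists (\row_i (q i).1, \row_i (q i).2) => //.
  set B := Q _; case: asboolP => [_ i|BU].
    by rewrite !mxE; have [] := qP i.
  exfalso; apply: BU => y By; apply: PU => i j; rewrite ord1.
  by have [_] := qP j; apply; have := By j; rewrite !mxE.
apply: (@countable_bigcupT_measurable _
  (caratheodory_type (@lebesgue_outer R m))); first exact: countableP.
by move=> q; case: ifP => _; [exact: measurable_box|exact: measurable0].
Qed.

(** * Norms as integrals, Cauchy-Schwarz and Markov estimates *)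

Lemma Lnorm1_restrict {d} {T : measurableType d} {R : realType}
    (mu : {measure set T -> \bar R}) (D : set T) (f : T -> R) :
  'N[mu]_1[EFin \o (f \_ D)] = \int[mu]_(x in D) `|f x|%:E.
Proof.
rewrite Lnorm1 [RHS]integral_mkcond; apply: eq_integral => x _ /=.
by rewrite !patchE; case: ifP; rewrite ?normr0.
Qed.

Lemma Lnorm2_restrict {d} {T : measurableType d} {R : realType}
    (mu : {measure set T -> \bar R}) (D : set T) (f : T -> R) :
  'N[mu]_2%:E[EFin \o (f \_ D)] ^+ 2 = \int[mu]_(x in D) (f x ^+ 2)%:E.
Proof.
have int_ge0 : 0 <= \int[mu]_x (`|(f \_ D) x| `^ 2)%:E.
  by apply: integral_ge0 => x _; rewrite lee_fin powR_ge0.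
rewrite unlock /= poweR12_sqrt// -expe2 sqr_sqrte//.
rewrite [RHS]integral_mkcond; apply: eq_integral => x _ /=.
rewrite powR_mulrn// -normrX ger0_norm ?sqr_ge0// !patchE.
by case: ifP; rewrite ?expr0n.
Qed.

(** Hölder's inequality with both exponents 2, applied to the indicator of [D] and to [f] restricted
    to [D]. *)
Lemma sqr_integral_norm_le {d} {T : measurableType d} {R : realType}
    (mu : {measure set T -> \bar R}) (D : set T) (f : T -> R) :
  measurable D -> measurable_fun D f ->
  (\int[mu]_(x in D) `|f x|%:E) ^+ 2 <=
    mu D * \int[mu]_(x in D) (f x ^+ 2)%:E.
Proof.
move=> mD mf.
have -> : mu D = 'N[mu]_2%:E[EFin \o ((fun=> 1%R : R) \_ D)] ^+ 2.
  rewrite Lnorm2_restrict -[LHS]mul1e -integral_cst//.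
  by apply: eq_integral => x _ /=; rewrite expr1n.
rewrite -Lnorm1_restrict -Lnorm2_restrict.
set a := 'N[mu]_2%:E[_]; set b := 'N[mu]_2%:E[_].
have -> : a ^+ 2 * b ^+ 2 = (a * b) ^+ 2 by rewrite !expe2 muleACA.
rewrite lee_sqr ?mule_ge0 ?Lnorm_ge0//.
have -> : f \_ D = (((fun=> 1%R : R) \_ D) \* (f \_ D))%R.
  by apply/funext => x /=; rewrite !patchE; case: ifP; rewrite ?mul1r ?mul0r.
apply: hoelder => //; last by lra.
- exact/(measurable_restrictT _ mD).
- exact/(measurable_restrictT _ mD).
Qed.

(** Cauchy-Schwarz on [A] and on its complement in [D], joined by [(a + b)^2 <= 2 (a^2 + b^2)].
    Under localisation the first term is small because of [mu A], the second because of its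
    integral. *)
Lemma sqr_integral_split_le {d} {T : measurableType d} {R : realType}
    (mu : {measure set T -> \bar R}) (D A : set T) (f : T -> R) :
  measurable D -> measurable A -> A `<=` D -> measurable_fun D f ->
  (\int[mu]_(x in D) `|f x|%:E) ^+ 2 <=
    2%:E * (mu A * \int[mu]_(x in A) (f x ^+ 2)%:E +
            mu D * \int[mu]_(x in D `\` A) (f x ^+ 2)%:E).
Proof.
move=> mD mA AD mf; have mDA : measurable (D `\` A) by exact: measurableD.
have int_ge0 (g : T -> R) B : (forall x, 0 <= g x)%R ->
    0 <= \int[mu]_(x in B) (g x)%:E.
  by move=> g0; apply: integral_ge0 => x _; rewrite lee_fin.
have mfA : measurable_fun A f by exact: measurable_funS mf.
have mfDA : measurable_fun (D `\` A) f.
  by apply: measurable_funS mf => //; exact: subDsetl.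
have D_AU : D = A `|` (D `\` A) by rewrite setDUK.
rewrite [X in \int[_]_(x in X) _]D_AU ge0_integral_setU//; last 2 first.
- by rewrite -D_AU; apply/measurable_EFinP; exact: measurableT_comp.
- by apply/disj_setPS => x [? []].
apply: (@le_trans _ _ (2%:E * ((\int[mu]_(x in A) `|f x|%:E) ^+ 2 +
    (\int[mu]_(x in D `\` A) `|f x|%:E) ^+ 2))).
  have := int_ge0 (fun x => `|f x|)%R A (fun=> normr_ge0 _).
  have := int_ge0 (fun x => `|f x|)%R (D `\` A) (fun=> normr_ge0 _).
  (* For finite values this is [(a - b)^2 >= 0]; if one integral is infinite, the right-hand side is
     [+oo]. *)
  case: (\int[mu]_(x in A) _) => [a| |]//;
    case: (integral mu (D `\` A) _) => [b| |]//=.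
  - move=> _ _; rewrite lee_fin.
    by have := sqr_ge0 (a - b)%R; rewrite expr2; lra.
  - by rewrite mulr_infty gtr0_sg// mul1e leey.
  - by rewrite mulr_infty gtr0_sg// mul1e leey.
  - by rewrite mulr_infty gtr0_sg// mul1e leey.
rewrite lee_pmul2l//; apply: leeD; first exact: sqr_integral_norm_le.
apply: le_trans (sqr_integral_norm_le mu _ _ mDA mfDA) _.
rewrite lee_wpmul2r// ?int_ge0// => [x|]; first exact: sqr_ge0.
by apply: le_measure; rewrite ?inE//; exact: subDsetl.
Qed.

(** The first bound is Markov's inequality; the second holds because [f^2 = |f| |f| <= a |f|] where
    [|f| < a]. *)
Lemma superlevel_estimate {d} {T : measurableType d} {R : realType}
    (mu : {measure set T -> \bar R}) (D : set T) (f : T -> R) (a : R) :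
  measurable D -> measurable_fun D f -> (0 < a)%R ->
  let A := D `&` [set x | a%:E <= `|(f x)%:E|] in
  [/\ measurable A,
      a%:E * mu A <= \int[mu]_(x in D) `|f x|%:E &
      \int[mu]_(x in D `\` A) (f x ^+ 2)%:E <=
        a%:E * \int[mu]_(x in D) `|f x|%:E].
Proof.
move=> mD mf a0 A.
have mEf : measurable_fun D (EFin \o f) by exact/measurable_EFinP.
have mEn : measurable_fun D (fun x => `|f x|%:E).
  by apply/measurable_EFinP; exact: measurableT_comp.
have mA : measurable A by exact: emeasurable_fun_c_infty.
have mDA : measurable (D `\` A) by exact: measurableD.
split=> //; first exact: le_integral_abse.
rewrite -ge0_integralZl_EFin//; last exact: ltW.
apply: (@le_trans _ _ (\int[mu]_(x in D `\` A) (a%:E * `|f x|%:E))).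
  apply: ge0_le_integral => //.
  - by move=> x _; rewrite lee_fin sqr_ge0.
  - apply/measurable_EFinP; apply: measurable_funX.
    by apply: measurable_funS mf => //; exact: subDsetl.
  - apply: measurable_funeM.
    by apply: measurable_funS mEn => //; exact: subDsetl.
  - move=> x [Dx nA]; rewrite -EFinM lee_fin -[leLHS]real_normK ?num_real//.
    rewrite expr2 ler_wpM2r// leNgt; apply/negP => af; apply: nA; split => //.
    by rewrite /= lee_fin ltW.
apply: ge0_subset_integral => //.
- exact: measurable_funeM.
- by move=> x _; rewrite mule_ge0// lee_fin ltW.
Qed.

(** * The equivalence over an arbitrary measure *)

Lemma localisation_criterion {d} {T : measurableType d} {R : realType}
    (mu : {measure set T -> \bar R}) (D : nat -> set T) (f : nat -> T -> R) :
  (forall n, measurable (D n)) -> (forall n, mu (D n) < +oo) ->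
  (forall n, measurable_fun (D n) (f n)) ->
  (forall n, \int[mu]_(x in D n) (f n x ^+ 2)%:E = 1) ->
  (exists A : nat -> set T,
    [/\ forall n, measurable (A n),
        forall n, A n `<=` D n,
        mu (A n) / mu (D n) @[n --> \oo] --> 0 &
        \int[mu]_(x in A n) (f n x ^+ 2)%:E @[n --> \oo] --> 1]) <->
  (mu (D n))^-1 * (\int[mu]_(x in D n) `|f n x|%:E) ^+ 2 @[n --> \oo] --> 0.
Proof.
move=> mD Dfin mf f1.
pose w n := fine (mu (D n)).
have wE n : mu (D n) = (w n)%:E by rewrite fineK// ge0_fin_numE.
(* On a null set the integral of [f^2] would be 0 instead of 1. *)
have w0 n : (0 < w n)%R.
  rewrite lt_neqAle fine_ge0// andbT eq_sym; apply/negP => /eqP wn0.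
  have := f1 n; rewrite null_set_integral//.
  - by move=> /eqP; rewrite eqe eq_sym oner_eq0.
  - by apply/measurable_EFinP; exact: measurable_funX.
  - by rewrite wE wn0.
have wVE n : (mu (D n))^-1 = (w n)^-1%:E by rewrite wE inver gt_eqF.
pose r n := fine (\int[mu]_(x in D n) `|f n x|%:E).
have N0 n : 0 <= \int[mu]_(x in D n) `|f n x|%:E by apply: integral_ge0.
(* Cauchy-Schwarz bounds the square of this integral by [w n], so it is finite. *)
have rE n : \int[mu]_(x in D n) `|f n x|%:E = (r n)%:E.
  rewrite fineK// ge0_fin_numE//.
  have := sqr_integral_norm_le mu _ _ (mD n) (mf n); rewrite f1 wE mule1.
  by move: (N0 n); case: (integral mu (D n) _) => [x| |]//= _ _; rewrite ltry.
have r0 n : (0 <= r n)%R by rewrite fine_ge0.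
have cE : (fun n => (mu (D n))^-1 * (\int[mu]_(x in D n) `|f n x|%:E) ^+ 2) =
    (fun n => ((w n)^-1 * r n ^+ 2)%:E).
  by apply/funext => n; rewrite wVE rE -EFin_expe -EFinM.
rewrite {}cE.
have int_split n B : measurable B -> B `<=` D n ->
    \int[mu]_(x in B) (f n x ^+ 2)%:E +
    \int[mu]_(x in D n `\` B) (f n x ^+ 2)%:E = 1.
  move=> mB BD; rewrite -ge0_integral_setU ?setDUK//.
  - exact: measurableD.
  - by apply/measurable_EFinP; exact: measurable_funX.
  - by move=> x _; rewrite lee_fin sqr_ge0.
  - by apply/disj_setPS => x [? []].
have int_ge0 n B : 0 <= \int[mu]_(x in B) (f n x ^+ 2)%:E.
  by apply: integral_ge0 => x _; rewrite lee_fin sqr_ge0.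
split=> [[A [mA AD A0 fA1]]|c0].
  (* Localisation sends both summands of this upper bound to 0. *)
  apply: (@squeeze_cvge _ _ _ _ (cst 0) _ (fun n =>
    2%:E * (mu (A n) / mu (D n) + (1 - \int[mu]_(x in A n) (f n x ^+ 2)%:E)))).
  - near=> n; rewrite lee_fin mulr_ge0 ?sqr_ge0 ?invr_ge0 ?(ltW (w0 n))//=.
    have := sqr_integral_split_le mu _ _ _ (mD n) (mA n) (@AD n) (mf n).
    have := int_split _ _ (mA n) (@AD n).
    have : mu (A n) <= mu (D n) by apply: le_measure; rewrite ?inE.
    have : 0 <= mu (A n) by [].
    rewrite rE wVE wE; move: (int_ge0 n (A n)) (int_ge0 n (D n `\` A n)).
    case: (integral mu (A n) _) => [q| |]//;
      case: (integral mu (D n `\` A n) _) => [q'| |]//.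
    case: (mu (A n)) => [a| |]// + + + _ [qq'].
    rewrite /= !lee_fin => q0 q'0 a0.
    (* After multiplication by [w n], the split estimate gives the bound once [a * q] is replaced by
       [a], which is allowed since [q <= 1]. *)
    have -> : (q' = 1 - q)%R by lra.
    move=> rle; rewrite ler_pdivrMl//.
    have -> : (w n * (2 * (a / w n + (1 - q))) = 2 * (a + w n * (1 - q)))%R.
      by field; rewrite gt_eqF.
    have : (a * q <= a)%R by rewrite ler_piMr//; lra.
    rewrite expr2; lra.
  - exact: cvg_cst.
  - rewrite [X in _ --> X](_ : 0 = 2%:E * (0 + (1 - 1))); last first.
      by rewrite subee// adde0 mule0.
    apply: cvgeZl => //; apply: cvgeD => //.
    by apply: cvgeB => //; exact: cvg_cst.
(* This is the [c_n] of the outline; it tends to 0 by continuity of the square root. *)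
pose u n := Num.sqrt ((w n)^-1 * r n ^+ 2).
have u0 : u n @[n --> \oo] --> (0 : R)%R.
  rewrite -[X in _ --> X]sqrtr0; apply: continuous_cvg.
    exact: sqrt_continuous.
  by move/fine_cvgP : c0 => [].
have uE n : u n = ((Num.sqrt (w n))^-1 * r n)%R.
  by rewrite /u sqrtrM ?invr_ge0 ?ltW// sqrtrV ?ltW// sqrtr_sqr ger0_norm.
have s0 n : (0 < (Num.sqrt (w n))^-1)%R by rewrite invr_gt0 sqrtr_gt0.
(* This threshold balances the two estimates: the relative measure of [A n] and the integral of
   [f^2] off [A n] get the same bound [u n]. *)
pose A n := D n `&` [set x | (Num.sqrt (w n))^-1%:E <= `|(f n x)%:E|].
have AP n := superlevel_estimate mu _ _ _ (mD n) (mf n) (s0 n).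
have mA n : measurable (A n) by have [] := AP n.
have AD n : A n `<=` D n by exact: subIsetl.
exists A; split=> //.
  apply: (@squeeze_cvge _ _ _ _ (cst 0) _ (EFin \o u));
    last by apply/fine_cvgP; split; [exact: nearW|exact: u0].
    near=> n; rewrite wVE mule_ge0//= ?lee_fin ?invr_ge0 ?(ltW (w0 n))//.
    have [_ + _] := AP n; rewrite -/(A n) rE uE.
    have : mu (A n) <= mu (D n) by apply: le_measure; rewrite ?inE.
    have : 0 <= mu (A n) by [].
    rewrite wE; case: (mu (A n)) => [a| |]//; rewrite -!EFinM !lee_fin => a0 _.
    have sw : (0 < Num.sqrt (w n))%R by rewrite sqrtr_gt0.
    have -> : (w n)^-1%R = ((Num.sqrt (w n))^-1 * (Num.sqrt (w n))^-1)%R.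
      by rewrite -invfM -expr2 sqr_sqrtr// ltW.
    by move=> ar; rewrite mulrCA ler_pM2l// mulrC.
  exact: cvg_cst.
(* The mass on [A n] is 1 minus the mass off it, hence lies between [1 - u n] and 1. *)
apply: (@squeeze_cvge _ _ _ _ (EFin \o (fun n => 1 - u n)%R) _ (cst 1)).
- near=> n; have [_ _] := AP n; rewrite -/(A n) rE -EFinM -uE /=.
  have := int_split _ _ (mA n) (AD n).
  move: (int_ge0 n (A n)) (int_ge0 n (D n `\` A n)).
  case: (integral mu (A n) _) => [q| |]//;
    case: (integral mu (D n `\` A n) _) => [q'| |]//.
  rewrite !lee_fin => q0 q'0 [qq'] q'u; apply/andP; split; lra.
- apply/fine_cvgP; split; first exact: nearW.
  rewrite -[X in _ --> X]subr0; apply: cvgB => //; exact: cvg_cst.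
- exact: cvg_cst.
Unshelve. all: by end_near. Qed.

(** * Specialisation to Lebesgue measure on open sets *)

Theorem lemma3 (R : realType) (m : nat) (hm : (2 <= m)%N)
    (Omega : nat -> set 'rV[R]_m) (f : nat -> 'rV[R]_m -> R)
    (Omega_open : forall n, open (Omega n))
    (Omega_nonempty : forall n, Omega n !=set0)
    (Omega_finite : forall n, lebesgue_rV (Omega n) < +oo)
    (f_L2 : forall n, in_L2 (Omega n) (f n))
    (f_norm1 : forall n, Lp_norm (Omega n) 2%:E (f n) = 1)
    (f_ge0 : forall n,
      {ae lebesgue_rV, forall x, Omega n x -> (0 <= f n x)%R}) :
  localises Omega f <->
  (lebesgue_rV (Omega n))^-1 * Lp_norm (Omega n) 1 (f n) ^+ 2
    @[n --> \oo] --> 0.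
Proof.
have mO n :
    measurable (Omega n : set (caratheodory_type (@lebesgue_outer R m))).
  exact: open_measurable_rV.
have mf n := (f_L2 n).1.
have NE n : Lp_norm (Omega n) 1 (f n) =
    \int[lebesgue_rV]_(x in Omega n) `|f n x|%:E by exact: Lnorm1_restrict.
under [X in _ <-> (X x @[x --> _] --> _)]eq_fun do rewrite NE.
apply: localisation_criterion => //.
move=> n; rewrite -Lnorm2_restrict.
by have := f_norm1 n; rewrite /Lp_norm => ->; rewrite expe2 mule1.
Qed.
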